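(* A generalized bitopological space $(X,\mu_1,\mu_2)$ is pairwise $T_{\frac14}$ if and only if every finite subset of $X$ is pairwise $\lambda$-closed.
   Context: A generalized topology on a nonempty set $X$ is a collection $\mu$ of subsets of $X$ that contains $\emptyset$ and is closed under arbitrary unions ($X$ itself need not belong to $\mu$). Members of $\mu$ are called $\mu$-open and their complements $\mu$-closed. A generalized bitopological space (GBT-space) $(X,\mu_1,\mu_2)$ is a nonempty set $X$ with two generalized topologies $\mu_1,\mu_2$. The space is pairwise $T_{\frac14}$ if for every finite subset $P$ of $X$ and every $y\in X-P$ there exists a set $A_y$ containing $P$ and disjoint from $\{y\}$ such that $A_y$ is $\mu_i$-open for some $i\in\{1,2\}$ or $\mu_j$-closed for some $j\in\{1,2\}$. For $A\subset X$, $A_{\mu}^{\wedge}=\bigcap\{U\in\mu: A\subset U\}$ (equal to $X$ if no $\mu$-open set contains $A$); $A$ is a $\wedge_{\mu}$-set if $A=A_{\mu}^{\wedge}$. $A$ is pairwise $\lambda$-closed if $A=(F_1\cap F_2)\cap(L_1\cap L_2)$ where $F_1,F_2$ are respectively $\mu_1$-closed and $\mu_2$-closed and $L_1,L_2$ are respectively a $\wedge_{\mu_1}$-set and a $\wedge_{\mu_2}$-set. *)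

(* Defs.v *)
From mathcomp Require Import all_boot.
From mathcomp Require Import boolp classical_sets cardinality.

Set Implicit Arguments.
Unset Strict Implicit.
Unset Printing Implicit Defensive.

Local Open Scope classical_set_scope.

Definition is_generalized_topology (X : Type) (mu : set (set X)) : Prop :=
  mu set0 /\
  (forall C : set (set X), C `<=` mu -> mu (\bigcup_(U in C) U)).

Record gbtSpace : Type := GBTSpace {
  gbt_carrier :> Type;
  gbt_nonempty : [set: gbt_carrier] !=set0;
  mu1 : set (set gbt_carrier);
  mu2 : set (set gbt_carrier);
  mu1_gt : is_generalized_topology mu1;
  mu2_gt : is_generalized_topology mu2
}.

Definition mu_open (X : Type) (mu : set (set X)) (A : set X) : Prop := mu A.

Definition mu_closed (X : Type) (mu : set (set X)) (A : set X) : Prop :=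
  mu_open mu (~` A).

(* The intersection of the empty family is setT, as the convention requires
   when no member of mu contains A. *)
Definition wedge (X : Type) (mu : set (set X)) (A : set X) : set X :=
  \bigcap_(U in [set U | mu_open mu U /\ A `<=` U]) U.

Definition is_wedge_set (X : Type) (mu : set (set X)) (A : set X) : Prop :=
  A = wedge mu A.

Definition pairwise_T14 (X : gbtSpace) : Prop :=
  forall P : set X, finite_set P -> forall y : X, ~ P y ->
  exists A : set X, [/\ P `<=` A, A `&` [set y] = set0 &
    (mu_open (@mu1 X) A \/ mu_open (@mu2 X) A) \/
    (mu_closed (@mu1 X) A \/ mu_closed (@mu2 X) A)].

Definition pairwise_lambda_closed (X : gbtSpace) (A : set X) : Prop :=
  exists F1 F2 L1 L2 : set X,
    [/\ mu_closed (@mu1 X) F1 /\ mu_closed (@mu2 X) F2,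
        is_wedge_set (@mu1 X) L1 /\ is_wedge_set (@mu2 X) L2 &
        A = (F1 `&` F2) `&` (L1 `&` L2)].

(* Main.v *)
(* The smallest mu-closed set containing P is the intersection of all mu-closed
   sets containing P, and its wedge is the intersection of all mu-open ones.
   Separating every point y outside P from P by an open or closed set of one of
   the two topologies thus means that P is the intersection of its two closures
   and its two wedges. *)
Require Import Defs.
From mathcomp Require Import all_boot.
From mathcomp Require Import boolp classical_sets cardinality.

Local Open Scope classical_set_scope.

(** By De Morgan this is the intersection of the closed supersets of [A]; as the complement of a
    union, it is closed directly by the union axiom. *)
Definition gclosure {X : Type} (mu : set (set X)) (A : set X) : set X :=
  ~` \bigcup_(U in [set U | mu_open mu U /\ A `<=` ~` U]) U.

Lemma sub_gclosure {X : Type} (mu : set (set X)) (A : set X) :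
  A `<=` gclosure mu A.
Proof. by move=> x Ax [U [_ AU] Ux]; exact: AU Ux. Qed.

Lemma gclosure_closed {X : Type} (mu : set (set X)) (A : set X) :
  is_generalized_topology mu -> mu_closed mu (gclosure mu A).
Proof.
move=> [_ muU]; rewrite /mu_closed /gclosure setCK.
by apply: muU => U [].
Qed.

Lemma gclosure_min {X : Type} (mu : set (set X)) (A F : set X) :
  mu_closed mu F -> A `<=` F -> gclosure mu A `<=` F.
Proof.
move=> Fcl AF x clx; apply: contrapT => nFx; apply: clx.
by exists (~` F) => //; split => //; rewrite setCK.
Qed.

Lemma sub_wedge {X : Type} (mu : set (set X)) (A : set X) : A `<=` wedge mu A.
Proof. by move=> x Ax U [_]; apply. Qed.

Lemma wedge_min {X : Type} (mu : set (set X)) (A U : set X) :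
  mu_open mu U -> A `<=` U -> wedge mu A `<=` U.
Proof. by move=> Uop AU x; apply. Qed.

(** An open set containing [A] already contains [wedge mu A], so both wedges intersect the same open
    sets. *)
Lemma wedge_is_wedge_set {X : Type} (mu : set (set X)) (A : set X) :
  is_wedge_set mu (wedge mu A).
Proof.
apply/seteqP; split; first exact: sub_wedge.
by move=> x wx U [Uop AU]; apply: wx; split => //; exact: wedge_min.
Qed.

Lemma wedge_set_separation {X : Type} (mu : set (set X)) (L : set X) (y : X) :
  is_wedge_set mu L -> ~ L y -> exists U, [/\ mu_open mu U, L `<=` U & ~ U y].
Proof.
move=> Lw nLy; apply: contrapT => nU; apply: nLy; rewrite Lw => U [Uop LU].
by apply: contrapT => nUy; apply: nU; exists U.
Qed.

Theorem theorem5p1 (X : gbtSpace) :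
  pairwise_T14 X <->
  (forall P : set X, finite_set P -> pairwise_lambda_closed P).
Proof.
split=> [T14 P Pfin | lam P Pfin y nPy].
- exists (gclosure (@mu1 X) P), (gclosure (@mu2 X) P),
         (wedge (@mu1 X) P), (wedge (@mu2 X) P); split.
  + by split; apply: gclosure_closed; [exact: mu1_gt | exact: mu2_gt].
  + by split; exact: wedge_is_wedge_set.
  + apply/seteqP; split=> [x Px | y [[c1 c2] [w1 w2]]].
      by split; split; (exact: sub_gclosure || exact: sub_wedge).
    apply: contrapT => nPy; have [A [PA /disjoints_subset Ay H]] := T14 P Pfin y nPy.
    (* Whichever kind [A] is, the matching wedge or closure of [P] contains [y] and lies inside
       [A]. *)
    suff Ay' : A y by exact: Ay Ay' erefl.
    case: H => [[]|[]] HA.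
    * exact: wedge_min HA PA _ w1.
    * exact: wedge_min HA PA _ w2.
    * exact: gclosure_min HA PA _ c1.
    * exact: gclosure_min HA PA _ c2.
- have [F1 [F2 [L1 [L2 [[F1c F2c] [L1w L2w] PE]]]]] := lam P Pfin.
  have disj (A : set X) : ~ A y -> A `&` [set y] = set0.
    by move=> nAy; apply/disjoints_subset => x Ax xy; apply: nAy; rewrite -xy.
  (* As [y] is outside [P], it misses one of the four factors. A closed factor itself separates [y]
     from [P]. *)
  have [F1y|/disj nF1y] := pselect (F1 y); last first.
    exists F1; split => //; last by right; left.
    by rewrite PE => x [[]].
  have [F2y|/disj nF2y] := pselect (F2 y); last first.
    exists F2; split => //; last by right; right.
    by rewrite PE => x [[]].
  (* A wedge factor need not be open, so an open superset of it that avoids [y] is used instead. *)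
  have [L1y|] := pselect (L1 y); last first.
    move=> /(wedge_set_separation _ _ _ L1w)[U [Uop LU /disj nUy]].
    exists U; split => //; last by left; left.
    by rewrite PE => x [_ [/LU]].
  have [L2y|] := pselect (L2 y); last first.
    move=> /(wedge_set_separation _ _ _ L2w)[U [Uop LU /disj nUy]].
    exists U; split => //; last by left; right.
    by rewrite PE => x [_ [_ /LU]].
  by case: nPy; rewrite PE.
Qed.
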